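(* $$\lim_{n\to\infty}\frac{t(4,n)}{r(4,n)}=0.$$
   Context: All graphs are finite and simple. In a graph $G=(V,E)$, a set $X\subseteq V$ is irredundant if every vertex $x\in X$ is either isolated in the induced subgraph $G[X]$, or has a private neighbor, i.e. a vertex $y\in V\setminus X$ adjacent to $x$ and to no other vertex of $X$. For a red-blue coloring of the edges of $K_N$, the blue (resp. red) subgraph is the spanning subgraph formed by the blue (resp. red) edges. The mixed Ramsey number $t(m,n)$ is the smallest $N$ such that every red-blue coloring of the edges of $K_N$ has an $m$-element irredundant set in the blue subgraph or an $n$-element independent set in the red subgraph. The Ramsey number $r(m,n)$ is the smallest $N$ such that every red-blue coloring of the edges of $K_N$ has an $m$-element independent set in the blue subgraph (equivalently, a red $K_m$) or an $n$-element independent set in the red subgraph (equivalently, a blue $K_n$). *)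

(* Defs.v *)
From mathcomp Require Import all_boot all_order all_algebra.
From mathcomp Require Import all_classical all_reals all_analysis.

Set Implicit Arguments.
Unset Strict Implicit.
Unset Printing Implicit Defensive.

Record sgraph (T : finType) := SGraph {
  adj :> rel T;
  adj_sym : symmetric adj;
  adj_irrefl : irreflexive adj }.

Section Graph.
Variables (T : finType) (G : sgraph T).
Implicit Types (X : {set T}) (x y : T).

Definition independent X : bool := [forall x in X, forall y in X, ~~ G x y].

Definition isolated_in X x : bool := [forall y in X, ~~ G x y].

Definition private_neighbor X x y : bool :=
  [&& y \notin X, G x y & [forall z in X, G z y ==> (z == x)]].

Definition irredundant X : bool :=
  [forall x in X, isolated_in X x || [exists y, private_neighbor X x y]].

Lemma independent_irredundant X : independent X -> irredundant X.
Proof.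
move=> /forall_inP iX; apply/forall_inP => x xX; apply/orP; left.
exact: iX.
Qed.

End Graph.

(* A red-blue colouring of the edges of K_N on the vertex set 'I_N; the edge
   {x, y} is red when [is_blue x y] is false. The values of [is_blue] on the
   diagonal carry no information, and are discarded below. *)
Record coloring (N : nat) := Coloring {
  is_blue : rel 'I_N;
  is_blue_sym : symmetric is_blue }.

Section Coloring.
Variables (N : nat) (c : coloring N).

Let blue_rel : rel 'I_N := fun x y => (x != y) && is_blue c x y.
Let red_rel : rel 'I_N := fun x y => (x != y) && ~~ is_blue c x y.

Fact blue_sym : symmetric blue_rel.
Proof. by move=> x y; rewrite /blue_rel eq_sym is_blue_sym. Qed.

Fact blue_irrefl : irreflexive blue_rel.
Proof. by move=> x; rewrite /blue_rel eqxx. Qed.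

Fact red_sym : symmetric red_rel.
Proof. by move=> x y; rewrite /red_rel eq_sym is_blue_sym. Qed.

Fact red_irrefl : irreflexive red_rel.
Proof. by move=> x; rewrite /red_rel eqxx. Qed.

Definition blue_graph : sgraph 'I_N := SGraph blue_sym blue_irrefl.
Definition red_graph : sgraph 'I_N := SGraph red_sym red_irrefl.

End Coloring.

Definition ramsey_prop (m n N : nat) : Prop :=
  forall c : coloring N,
    (exists X : {set 'I_N}, #|X| = m /\ independent (blue_graph c) X) \/
    (exists Y : {set 'I_N}, #|Y| = n /\ independent (red_graph c) Y).

Definition mixed_ramsey_prop (m n N : nat) : Prop :=
  forall c : coloring N,
    (exists X : {set 'I_N}, #|X| = m /\ irredundant (blue_graph c) X) \/
    (exists Y : {set 'I_N}, #|Y| = n /\ independent (red_graph c) Y).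

Lemma ramsey_aux (m n : nat) : exists N, forall (T : finType) (b : rel T),
  symmetric b -> forall S : {set T}, N <= #|S| ->
  (exists X : {set T}, [/\ X \subset S, #|X| = m &
     {in X &, forall x y, x != y -> ~~ b x y}]) \/
  (exists Y : {set T}, [/\ Y \subset S, #|Y| = n &
     {in Y &, forall x y, x != y -> b x y}]).
Proof.
have [k le_k] := ubnP (m + n).
elim: k m n le_k => // k IHk [|m] [|n] le_k.
1,2: by exists 0 => T b _ S _; left; exists finset.set0; split;
  rewrite ?finset.sub0set ?cards0 // => x y; rewrite inE.
  by exists 0 => T b _ S _; right; exists finset.set0; split;
  rewrite ?finset.sub0set ?cards0 // => x y; rewrite inE.
have [N1 P1] := IHk m n.+1 ltac:(by rewrite addSn in le_k).
have [N2 P2] := IHk m.+1 n ltac:(by rewrite addnS in le_k).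
exists (N1 + N2).+1 => T b bs S leS.
have /card_gt0P[v vS] : 0 < #|S| by exact: leq_trans leS.
pose A := [set x in S | (x != v) && ~~ b v x].
pose B := [set x in S | (x != v) && b v x].
have sAS : A \subset S by apply/fintype.subsetP=> x; rewrite inE => /andP[].
have sBS : B \subset S by apply/fintype.subsetP=> x; rewrite inE => /andP[].
have AB : (N1 <= #|A|) || (N2 <= #|B|).
  rewrite -[_ || _]negbK negb_or -!ltnNge; apply/negP => /andP[lA lB].
  have sub : S :\ v \subset A :|: B.
    apply/fintype.subsetP=> x; rewrite !inE => /andP[-> ->] /=.
    by case: (b v x).
  have := subset_leq_card sub; rewrite leqNgt => /negP; apply.
  apply: leq_ltn_trans (_ : #|A| + #|B| < _).
    by rewrite cardsU leq_subr.
  have := cardsD1 v S; rewrite vS add1n => e; rewrite e ltnS in leS.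
  apply: leq_trans leS; rewrite -addSn; apply: leq_add => //; exact: ltnW.
case/orP: AB => [/(P1 T b bs)|/(P2 T b bs)].
- case=> [[X [sX cX iX]]|[Y [sY cY iY]]]; last first.
    by right; exists Y; split=> //; exact: fintype.subset_trans sAS.
  left; exists (v |: X); split.
  + by rewrite finset.subUset finset.sub1set vS (fintype.subset_trans sX).
  + rewrite cardsU1 cX; case: (boolP (v \in X)) => // /(fintype.subsetP sX).
    by rewrite inE eqxx andbF.
  + have vb x : x \in X -> ~~ b v x.
      by move/(fintype.subsetP sX); rewrite inE => /and3P[].
    move=> x y /setU1P[->|xX] /setU1P[->|yX]; rewrite ?eqxx //.
    * by move=> _; apply: vb.
    * by move=> _; rewrite bs; apply: vb.
    * exact: iX.
- case=> [[X [sX cX iX]]|[Y [sY cY iY]]].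
    by left; exists X; split=> //; exact: fintype.subset_trans sBS.
  right; exists (v |: Y); split.
  + by rewrite finset.subUset finset.sub1set vS (fintype.subset_trans sY).
  + rewrite cardsU1 cY; case: (boolP (v \in Y)) => // /(fintype.subsetP sY).
    by rewrite inE eqxx andbF.
  + have vb x : x \in Y -> b v x.
      by move/(fintype.subsetP sY); rewrite inE => /and3P[].
    move=> x y /setU1P[->|xX] /setU1P[->|yX]; rewrite ?eqxx //.
    * by move=> _; apply: vb.
    * by move=> _; rewrite bs; apply: vb.
    * exact: iY.
Qed.

Lemma ramsey_exists m n : exists N, `[< ramsey_prop m n N >].
Proof.
have [N P] := ramsey_aux m n; exists N; apply/asboolP => c.
have := P _ _ (@is_blue_sym _ c) [set: 'I_N].
rewrite cardsT card_ord leqnn => /(_ isT)[[X [_ cX iX]]|[Y [_ cY iY]]].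
- left; exists X; split=> //; apply/forall_inP => x xX.
  apply/forall_inP => y yX; apply/negP => /andP[/(iX _ _ xX yX)].
  by move/negP.
- right; exists Y; split=> //; apply/forall_inP => x xX.
  apply/forall_inP => y yX; apply/negP => /andP[/(iY _ _ xX yX)].
  by move=> ->.
Qed.

Lemma mixed_ramsey_exists m n : exists N, `[< mixed_ramsey_prop m n N >].
Proof.
have [N /asboolP P] := ramsey_exists m n; exists N; apply/asboolP => c.
case: (P c) => [[X [cX iX]]|]; last by right.
by left; exists X; split=> //; exact: independent_irredundant.
Qed.

Definition ramsey (m n : nat) : nat := ex_minn (ramsey_exists m n).

Definition mixed_ramsey (m n : nat) : nat := ex_minn (mixed_ramsey_exists m n).

(* Main.v *)
Require Import Defs.
From mathcomp Require Import all_boot all_order all_algebra all_field.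
From mathcomp Require Import zify ring.
From mathcomp Require Import boolp.
Import GRing.Theory.

Set Implicit Arguments.
Unset Strict Implicit.
Unset Printing Implicit Defensive.

(* Upper bound. Let the red graph have no independent n-set and let the blue
   graph have no irredundant 4-set. Then every red neighbourhood is
   triangle-free and contains no hexagon v a b c b' a' whose antipodal pairs are
   all blue: adding the centre u, the set {u, v, b, b'} would be irredundant,
   with private neighbours c, a', a. A ball-growing argument shows that such a
   neighbourhood has O(n^(5/3)) vertices: if I is an independent subset of the
   neighbourhood of v, the vertices with exactly one neighbour in I span a
   graph which is a union of two independent sets, because, by
   hexagon-freeness, all neighbours of such a vertex c are dominated by the
   same vertex of I. Hence t(4,n) = O(n^(8/3)).

   Lower bound (Mattheus and Verstraete). In the Hermitian unital of order q, no
   four secant lines meet in six distinct points of the unital (O'Nan). Join two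
   secants when they meet in a point of the unital at which a random 2-colouring
   separates them: this graph is K4-free on about q^4 vertices. With positive
   probability every set of 8 q^2 secants spans many edges, so that by graph
   containers the independent sets of size n >> q log^2 q are few, and a random
   map from a set of size about n q^2 pulls none of them back. Hence r(4,n) is
   at least n^(3-o(1)). *)

(** * Upper bound for the mixed Ramsey number *)

Lemma leq_card_bigcup (I : Type) (T : finType) (r : seq I) (P : pred I) (F : I -> {set T}) :
  #|\bigcup_(i <- r | P i) F i| <= \sum_(i <- r | P i) #|F i|.
Proof.
elim/big_rec2: _ => [|i m A _ le]; first by rewrite cards0.
by rewrite (leq_trans (leq_card_setU _ _)) // leq_add2l.
Qed.

Section Upper.
Variables (T : finType) (G : sgraph T).
Implicit Types (U W I A : {set T}) (u v x y : T).

Lemma independentP I : reflect {in I &, forall x y, ~~ G x y} (independent G I).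
Proof.
apply: (iffP forall_inP) => [iI x y xI yI|iI x xI].
  exact: (forall_inP (iI x xI)).
by apply/forall_inP => y yI; apply: iI.
Qed.

Lemma independentS I A : I \subset A -> independent G A -> independent G I.
Proof.
move=> /subsetP sIA /independentP iA; apply/independentP => x y xI yI.
by apply: iA; apply: sIA.
Qed.

Lemma independent1 x : independent G [set x].
Proof. by apply/independentP => y z /set1P-> /set1P->; rewrite adj_irrefl. Qed.

Definition nbrs U I : {set T} := [set y in U | [exists x in I, G x y]].

Lemma mem_nbrs U I y : reflect (y \in U /\ exists2 x, x \in I & G x y) (y \in nbrs U I).
Proof.
rewrite inE; apply: (iffP andP) => [[-> /exists_inP[x]]|[-> [x xI xy]]].
  by split=> //; exists x.
by split=> //; apply/exists_inP; exists x.
Qed.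

Lemma nbrs_sub U I : nbrs U I \subset U.
Proof. by apply/subsetP => y /mem_nbrs[]. Qed.

Lemma expansion_independent D W :
  (forall U, U \subset W -> U != set0 -> exists I,
     [/\ I \subset U, I != set0, independent G I & #|I :|: nbrs U I| <= D * #|I|]) ->
  exists I, [/\ I \subset W, independent G I & #|W| <= D * #|I|].
Proof.
have [m] := ubnP #|W|; elim: m W => // m IHm W leW HW.
have [->|W0] := eqVneq W set0.
  by exists set0; rewrite sub0set cards0; split=> //; apply/independentP => x; rewrite inE.
have [I [sIW I0 iI cI]] := HW W (subxx _) W0.
pose W' := W :\: (I :|: nbrs W I).
have sNW : I :|: nbrs W I \subset W by rewrite subUset sIW nbrs_sub.
have cW : #|W| = #|I :|: nbrs W I| + #|W'|.
  by rewrite -(cardsID (I :|: nbrs W I) W) (setIidPr sNW).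
have I_gt0 : 0 < #|I| by rewrite card_gt0.
have cIN : #|I| <= #|I :|: nbrs W I| by rewrite subset_leq_card ?subsetUl.
have sW'W : W' \subset W by rewrite subsetDl.
have [|U sU|J [sJ iJ cJ]] := IHm W'; first by lia.
  by apply: HW; apply: subset_trans sU sW'W.
have dis x y : x \in I -> y \in J -> ~~ G x y.
  move=> xI /(subsetP sJ); rewrite !inE => /andP[]; rewrite negb_or => /andP[_ +] yW.
  by rewrite yW /= => /exists_inPn; apply.
exists (I :|: J); split.
- by rewrite subUset sIW (subset_trans sJ).
- apply/independentP => x y /setUP[xI|xJ] /setUP[yI|yJ].
  + exact: (independentP _ iI).
  + exact: dis.
  + by rewrite adj_sym; apply: dis.
  + exact: (independentP _ iJ).
- have: I :&: J = set0.
    apply/eqP; rewrite setI_eq0; apply/pred0P => x /=; apply/andP => -[xI /(subsetP sJ)].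
    by rewrite !inE xI.
  by rewrite cardsU => ->; rewrite cards0 subn0 mulnDr; lia.
Qed.

Definition triangle_free_on W :=
  {in W & &, forall x y z, G x y -> G y z -> ~~ G x z}.

(* An induced hexagon [v, a, b, c, b', a']: in a triangle-free graph the only
   possible chords join antipodal vertices. *)
Definition hexagon_free_on W := forall v a b c b' a',
  [/\ v \in W, a \in W & b \in W] -> [/\ c \in W, b' \in W & a' \in W] ->
  [/\ G v a, G a b & G b c] -> [/\ G c b', G b' a' & G a' v] ->
  [|| G v c, G a b' | G b a'].

Section UniqueDomination.
Variables (W I C : {set T}) (v : T) (p : T -> T).
Hypotheses (tfW : triangle_free_on W) (hfW : hexagon_free_on W).
Hypotheses (vW : v \in W) (sIW : I \subset W) (sCW : C \subset W).
Hypothesis vI : {in I, forall a, G v a}.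
Hypothesis pI : {in C, forall c, p c \in I}.
Hypothesis pG : {in C, forall c, G (p c) c}.
Hypothesis pU : {in C & I, forall c a, G a c -> a = p c}.

Let inW x : x \in C -> x \in W. Proof. exact: (subsetP sCW). Qed.
Let IinW x : x \in I -> x \in W. Proof. exact: (subsetP sIW). Qed.

Lemma dominator_const b c b' : b \in C -> c \in C -> b' \in C ->
  G c b -> G c b' -> p b = p b'.
Proof.
move=> bC cC b'C cb cb'; apply/eqP/negPn/negP => ne.
have [vp vp'] : G v (p b) /\ G v (p b') by rewrite !vI ?pI.
have [pb pb'] : G (p b) b /\ G (p b') b' by rewrite !pG.
have : [|| G v c, G (p b) b' | G b (p b')].
  by apply: hfW; split; do ?[exact: vW | exact: inW | exact/IinW/pI | by []];
    rewrite adj_sym.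
case/or3P => [vc|ab'|ba'].
- have := tfW vW (IinW (pI cC)) (inW cC) (vI (pI cC)) (pG cC).
  by rewrite vc.
- by case/eqP: ne; apply: pU => //; apply: pI.
- by case/eqP: ne; apply/esym/pU => //; rewrite ?pI // adj_sym.
Qed.

Lemma uniquely_dominated_bound n :
  (forall J : {set T}, J \subset W -> independent G J -> #|J| <= n) ->
  #|C| <= n.*2.
Proof.
move=> hn; pose r x : nat := enum_rank (p x).
pose P := [set c in C | [exists b in C, G c b && (r b < r c)]].
pose Q := C :\: P.
have sPC : P \subset C by apply/subsetP => x; rewrite inE => /andP[].
have sQC : Q \subset C by rewrite subsetDl.
have rP c c' : c \in P -> c' \in C -> G c c' -> r c' < r c.
  rewrite inE => /andP[cC /exists_inP[b bC /andP[cb lt]]] c'C cc'.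
  by rewrite /r (dominator_const c'C cC bC cc' cb).
have rQ c c' : c \in Q -> c' \in C -> G c c' -> r c <= r c'.
  rewrite inE => /andP[cP cC] c'C cc'; rewrite leqNgt; apply: contra cP => lt.
  by rewrite inE cC; apply/exists_inP; exists c'; rewrite // cc'.
have iP : independent G P.
  apply/independentP => x y xP yP; apply/negP => xy.
  have := rP _ _ xP (subsetP sPC _ yP) xy.
  by have := rP _ _ yP (subsetP sPC _ xP); rewrite adj_sym => /(_ xy); lia.
have iQ : independent G Q.
  apply/independentP => x y xQ yQ; apply/negP => xy.
  have xC := subsetP sQC _ xQ; have yC := subsetP sQC _ yQ.
  have l1 := rQ _ _ xQ yC xy.
  have := rQ _ _ yQ xC; rewrite adj_sym => /(_ xy) l2.
  have /enum_rank_inj e : enum_rank (p x) = enum_rank (p y).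
    by apply: val_inj => /=; apply/eqP; rewrite eqn_leq l1 l2.
  have := tfW (IinW (pI xC)) (inW xC) (inW yC) (pG xC) xy.
  by rewrite e pG.
have := hn P (subset_trans sPC sCW) iP.
have := hn Q (subset_trans sQC sCW) iQ.
have := cardsID P C; rewrite (setIidPr sPC) -/Q; lia.
Qed.

End UniqueDomination.

Lemma triangle_hexagon_free_bound n t W :
  triangle_free_on W -> hexagon_free_on W ->
  (forall J : {set T}, J \subset W -> independent G J -> #|J| <= n) ->
  n ^ 2 < t ^ 3 -> #|W| <= (t.*2.+1) * n.
Proof.
move=> tfW hfW hn ltn.
have t_gt0 : 0 < t by case: t ltn.
suff /expansion_independent[I [sIW iI cW]] : forall U, U \subset W -> U != set0 -> exists I,
     [/\ I \subset U, I != set0, independent G I & #|I :|: nbrs U I| <= t.*2.+1 * #|I|].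
  by apply: leq_trans cW _; rewrite leq_mul2l hn ?orbT.
move=> U sUW /set0Pn[v vU].
have tfU x y z : x \in U -> y \in U -> z \in U -> G x y -> G y z -> ~~ G x z.
  by move=> xU yU zU; apply: tfW; apply: (subsetP sUW).
pose A := nbrs U [set v].
have vA a : a \in A -> G v a by case/mem_nbrs => _ [x /set1P->].
have sAU : A \subset U := nbrs_sub _ _.
have [ltA|leA] := ltnP #|A| t.*2.+1.
  exists [set v]; rewrite sub1set vU independent1 cards1 muln1; split=> //.
    by apply/set0Pn; exists v; rewrite inE.
  by rewrite cardsU1; case: (v \notin _); rewrite -/A; lia.
have iA : independent G A.
  apply/independentP => a b aA bA; apply/negP => ab.
  by have /negP := tfU _ _ _ vU (subsetP sAU _ aA) (subsetP sAU _ bA) (vA _ aA) ab; rewrite vA.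
have A0 : A != set0 by rewrite -card_gt0; lia.
have [le|ltS] := leqP #|A :|: nbrs U A| (t.*2.+1 * #|A|).
  by exists A.
exfalso.
pose S I := nbrs U I :\ v.
have SA : t.*2 * #|A| <= #|S A|.
  have [+ _] := leq_card_setU A (nbrs U A); have := cardsD1 v (nbrs U A).
  rewrite -/(S A); move: ltS; rewrite mulSn; case: (v \in _) => /=; lia.
(* Maximality of [f J] forces every vertex of [J] to have at least [t] private
   neighbours in [S J]. *)
pose f (I : {set T}) := #|S I| + t * #|A :\: I|.
have [J sJA maxJ] : exists2 J : {set T}, J \subset A & forall K : {set T}, K \subset A -> f K <= f J.
  case: (arg_maxnP (P := fun J : {set T} => J \subset A) f (subxx A)) => J sJA maxJ.
  by exists J.
have SJ : t * #|A| <= #|S J|.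
  have := maxJ A (subxx _); rewrite /f setDv cards0 muln0 addn0.
  have := subset_leq_card (subsetDl A J); nia.
have inWU x : x \in U -> x \in W by apply: (subsetP sUW).
have cS I : I \subset A -> #|S I| <= n * #|I|.
  move=> sIA; rewrite /S.
  have -> : n * #|I| = \sum_(a in I) n by rewrite sum_nat_const mulnC.
  apply: leq_trans (subset_leq_card (subsetDl _ _)) _.
  have -> : nbrs U I = \bigcup_(a in I) nbrs U [set a].
    apply/setP => y; apply/mem_nbrs/bigcupP => [[yU [x xI xy]]|[x xI /mem_nbrs[yU [z /set1P-> xy]]]].
      by exists x => //; apply/mem_nbrs; split=> //; exists x; rewrite ?inE.
    by split=> //; exists x.
  apply: leq_trans (leq_card_bigcup _ _ _) _; apply: leq_sum => a aI; apply: hn.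
    by apply: subset_trans (nbrs_sub _ _) sUW.
  apply/independentP => x y /mem_nbrs[xU [_ /set1P-> ax]] /mem_nbrs[yU [_ /set1P-> ay]].
  apply/negP => xy; have aU : a \in U by apply/(subsetP sAU)/(subsetP sIA).
  by have := tfU _ _ _ aU xU yU ax xy; rewrite ay.
have priv a : a \in J -> t <= #|S J :\: S (J :\ a)|.
  move=> aJ; have sJa : J :\ a \subset A by apply: subset_trans sJA; apply: subsetDl.
  have := maxJ _ sJa; rewrite /f.
  have -> : #|A :\: (J :\ a)| = #|A :\: J|.+1.
    have -> : A :\: (J :\ a) = a |: (A :\: J).
      apply/setP => x; rewrite in_setU1 in_setD in_setD1 in_setD.
      by case: eqVneq => [->|] //=; apply: (subsetP sJA).
    by rewrite cardsU1 in_setD aJ.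
  have := cardsID (S (J :\ a)) (S J).
  have := subset_leq_card (subsetIr (S J) (S (J :\ a))).
  lia.
pose p c := odflt v [pick a in J | G a c].
pose C := \bigcup_(a in J) (S J :\: S (J :\ a)).
have CP c a : a \in J -> c \in S J :\: S (J :\ a) ->
  [/\ c \in U, G a c & forall b, b \in J -> G b c -> b = a].
  rewrite inE => aJ /andP[cSa /setD1P[cv /mem_nbrs[cU [b bJ bc]]]].
  have u b' : b' \in J -> G b' c -> b' = a.
    move=> b'J b'c; apply/eqP/negPn/negP => ne; case/negP: cSa.
    by apply/setD1P; split=> //; apply/mem_nbrs; split=> //; exists b'; rewrite // !inE ne.
  by split=> //; rewrite -(u b bJ bc).
have pC c a : a \in J -> c \in S J :\: S (J :\ a) -> p c = a.
  move=> aJ cS'; have [cU ac u] := CP _ _ aJ cS'.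
  rewrite /p; case: pickP => [b /andP[bJ bc]|/(_ a)] /=; first exact: u.
  by rewrite aJ ac.
have cC : t * #|J| <= #|C|.
  have inC c : c \in C -> p c \in J.
    by move=> /bigcupP[a aJ cS']; rewrite (pC _ _ aJ cS').
  rewrite -[leqRHS]sum1_card (partition_big p (mem J)) //= mulnC -sum_nat_const.
  apply: leq_sum => a aJ; apply: leq_trans (priv a aJ) _.
  rewrite sum1_card; apply/subset_leq_card/subsetP => c cS'.
  by rewrite unfold_in /= (pC _ _ aJ cS') eqxx andbT; apply/bigcupP; exists a.
have := cS _ sJA.
have cC2 : #|C| <= n.*2.
  apply: (@uniquely_dominated_bound W J C v p) => //.
  - exact: inWU.
  - by apply: subset_trans sJA _; apply: subset_trans sAU _.
  - by apply/subsetP => c /bigcupP[a aJ /CP[]// cU _ _]; apply: inWU.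
  - by move=> a aJ; apply/vA/(subsetP sJA).
  - by move=> c /bigcupP[a aJ cS']; rewrite (pC _ _ aJ cS').
  - by move=> c /bigcupP[a aJ cS']; rewrite (pC _ _ aJ cS'); case: (CP _ _ aJ cS').
  - move=> c b /bigcupP[a aJ cS'] bJ bc; rewrite (pC _ _ aJ cS'); case: (CP _ _ aJ cS') => _ _; exact.
move=> cSJ.
have h1 : t * #|A| <= n * #|J| by lia.
have h2 : t * #|J| <= n.*2 by lia.
suff : t ^ 3 <= n ^ 2 by lia.
have h3 : t * (t * #|A|) <= n * n.*2.
  by apply: leq_trans (_ : t * (n * #|J|) <= _); nia.
rewrite !expnS expn0; nia.
Qed.

End Upper.

Lemma exists_subset_card (T : finType) (A : {set T}) n :
  n <= #|A| -> exists2 B : {set T}, B \subset A & #|B| = n.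
Proof.
move=> le; exists [set x in take n (enum A)].
  by apply/subsetP => x; rewrite inE => /mem_take; rewrite mem_enum.
by rewrite cardsE (card_uniqP _) ?take_uniq ?enum_uniq // size_takel // -cardE.
Qed.

Lemma cards4 (T : finType) (a b c d : T) :
  uniq [:: a; b; c; d] -> #|[set a; b; c; d]| = 4.
Proof.
move=> u; have <- : [set x in [:: a; b; c; d]] = [set a; b; c; d].
  by apply/setP => x; rewrite !inE -!orbA.
by rewrite cardsE (card_uniqP u).
Qed.

Section MixedUpper.
Variables (N : nat) (c : coloring N).
Let R := red_graph c.
Let B := blue_graph c.

Lemma red_blue x y : R x y -> B x y = false.
Proof. by move=> /andP[/= -> /negbTE ->]. Qed.

Lemma nred_blue x y : x != y -> ~~ R x y -> B x y.
Proof. by rewrite /= => ->; rewrite negbK. Qed.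

Lemma red_neq x y : R x y -> x != y.
Proof. by case/andP. Qed.

Lemma irredundant_red_K4 a b d e :
  [/\ R a b, R a d & R a e] -> [/\ R b d, R b e & R d e] ->
  irredundant B [set a; b; d; e] /\ #|[set a; b; d; e]| = 4.
Proof.
move=> [ab ad ae] [bd be de]; split; last first.
  by rewrite cards4 //= !inE !negb_or !red_neq.
apply: independent_irredundant; apply/independentP => x y.
rewrite !inE => /orP[/orP[/orP[]|]|] /eqP-> /orP[/orP[/orP[]|]|] /eqP->;
  by rewrite ?adj_irrefl // red_blue // adj_sym.
Qed.

Lemma irredundant_red_hexagon u v a b d b' a' :
  [/\ R u v, R u a & R u b] -> [/\ R u d, R u b' & R u a'] ->
  [/\ R v a, R a b & R b d] -> [/\ R d b', R b' a' & R a' v] ->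
  [/\ v != d, a != b' & b != a'] -> [/\ v != b, v != b' & b != b'] ->
  ~~ [|| R v d, R a b' | R b a'] ->
  irredundant B [set u; v; b; b'] /\ #|[set u; v; b; b']| = 4.
Proof.
move=> [uv ua ub] [ud ub' ua'] [va ab bd] [db' b'a' a'v] [vd ab' ba'] [vb vb' bb'].
rewrite !negb_or => /and3P[nvd nab' nba'].
split; last by rewrite cards4 //= !inE !negb_or (red_neq uv) (red_neq ub) (red_neq ub') vb vb' bb'.
have priv (X : {set 'I_N}) x y : x != y -> ~~ R x y ->
    (forall z, z \in X -> z != x -> R z y) -> private_neighbor B X x y.
  move=> xy nxy H; apply/and3P; split; last 1 first.
  - apply/forall_inP => z zX; apply/implyP; apply: contraLR => zx.
    by rewrite red_blue ?H.
  - apply/negP => yX; have := H y yX; rewrite eq_sym xy => /(_ isT).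
    by rewrite adj_irrefl.
  - exact: nred_blue.
apply/forall_inP => x; rewrite 3!in_setU !in_set1.
case/orP=> [/orP[/orP[]|]|] /eqP->; apply/orP; [left | right | right | right].
- apply/forall_inP => y; rewrite 3!in_setU !in_set1.
  by case/orP=> [/orP[/orP[]|]|] /eqP->; rewrite ?adj_irrefl // red_blue.
- apply/existsP; exists d; apply: priv => // z; rewrite 3!in_setU !in_set1.
  by case/orP=> [/orP[/orP[]|]|] /eqP->; rewrite ?eqxx // adj_sym.
- apply/existsP; exists a'; apply: priv => // z; rewrite 3!in_setU !in_set1.
  by case/orP=> [/orP[/orP[]|]|] /eqP->; rewrite ?eqxx // adj_sym.
- apply/existsP; exists a; apply: priv; rewrite 1?adj_sym 1?eq_sym // => z.
  rewrite 3!in_setU !in_set1.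
  by case/orP=> [/orP[/orP[]|]|] /eqP->; rewrite ?eqxx // adj_sym.
Qed.

End MixedUpper.

Lemma mixed_ramsey_upper n t :
  n ^ 2 < t ^ 3 -> mixed_ramsey 4 n <= (t.*2.+1 * n).+1 * n.
Proof.
move=> ltn; rewrite /mixed_ramsey; case: ex_minnP => m _; apply; apply/asboolP.
move eN: ((t.*2.+1 * n).+1 * n) => N c.
apply: contrapT => /not_orP[nX nY].
pose R := red_graph c.
have hn (J : {set 'I_N}) : independent R J -> #|J| < n.
  move=> iJ; rewrite ltnNge; apply/negP => /exists_subset_card[Y sYJ cY].
  by apply: nY; exists Y; split=> //; apply: independentS iJ.
suff [I [_ /hn ltI]] : exists I : {set 'I_N}, [/\ I \subset [set: 'I_N], independent R I &
    #|[set: 'I_N]| <= (t.*2.+1 * n).+1 * #|I|].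
  by rewrite cardsT card_ord; nia.
apply: expansion_independent => U _ /set0Pn[u uU].
exists [set u]; rewrite sub1set uU independent1 cards1 muln1; split=> //.
  by apply/set0Pn; exists u; rewrite inE.
have uW x : x \in nbrs R U [set u] -> R u x by case/mem_nbrs => _ [y /set1P->].
suff : #|nbrs R U [set u]| <= t.*2.+1 * n by rewrite cardsU1; case: (_ \notin _); lia.
have tf : triangle_free_on R (nbrs R U [set u]).
  move=> x y z /uW ux /uW uy /uW uz xy yz; apply/negP => xz; apply: nX.
  have [||iX cX] := @irredundant_red_K4 _ c u x y z; try by split.
  by exists [set u; x; y; z].
apply: (triangle_hexagon_free_bound (G := R)) (ltn) => //; last by move=> J _ /hn/ltnW.
move=> v a b d b' a' [vW aW bW] [dW b'W a'W].
move=> [va ab bd] [db' b'a' a'v]; apply/negPn/negP => nchord; apply: nX.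
have := nchord; rewrite !negb_or => /and3P[nvd nab' nba'].
have [|||||||iX cX] := @irredundant_red_hexagon _ c u v a b d b' a'; do ?by [split; do ?exact: uW | exact: nchord].
- split; apply/eqP => e.
  + by have := tf _ _ _ vW aW bW va ab; rewrite e adj_sym bd.
  + by have := tf _ _ _ aW bW dW ab bd; rewrite e adj_sym db'.
  + by have := tf _ _ _ dW b'W a'W db' b'a'; rewrite -e adj_sym bd.
- split; apply/eqP => e.
  + by move: nvd; rewrite e bd.
  + by move: nvd; rewrite e adj_sym db'.
  + by move: nab'; rewrite -e ab.
by exists [set u; v; b; b'].
Qed.

(** * Independent sets and containers *)

Definition link (T : finType) (G : sgraph T) (U : {set T}) (v : T) : {set T} :=
  [set y in U | G v y].

Definition degsum (T : finType) (G : sgraph T) (U : {set T}) :=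
  \sum_(v in U) #|link G U v|.

Section Containers.
Variables (T : finType) (G : sgraph T).
Implicit Types (A U I C : {set T}).

Lemma degsumD1 U : \sum_(v in U) degsum G (U :\ v) + (degsum G U).*2 = #|U| * degsum G U.
Proof.
have degE W x : #|link G W x| = \sum_(y in W) G x y.
  rewrite -sum1_card (eq_bigl (fun y => (y \in W) && G x y)) => [|y]; last by rewrite inE.
  by rewrite big_mkcondr; apply: eq_bigr => y _; case: (G x y).
have split1 v : v \in U -> degsum G U = degsum G (U :\ v) + (#|link G U v|).*2.
  move=> vU; rewrite /degsum (big_setD1 v vU) /= addnC -addnn addnA; congr (_ + _).
  rewrite [in RHS]degE (big_setD1 v vU) /= adj_irrefl add0n -big_split /=.
  apply: eq_bigr => x; rewrite inE => /andP[xv xU].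
  by rewrite !degE (big_setD1 v vU) /= adj_sym addnC.
rewrite -[#|U| * _]sum_nat_const /= [in RHS](eq_bigr _ split1) big_split /=; congr (_ + _).
by rewrite -addnn /degsum -big_split /=; apply: eq_bigr => v _; rewrite addnn.
Qed.

(* Averaging over the vertex-deleted subsets: [degsum U / (#|U| (#|U| - 1))]
   does not decrease from sets of size [R] to larger ones. *)
Lemma degsum_supersaturation R w U : 1 < R ->
  (forall U', #|U'| = R -> R * R.-1 <= w * degsum G U') ->
  R <= #|U| -> #|U| * #|U|.-1 <= w * degsum G U.
Proof.
move=> R1 HR; have [m] := ubnP #|U|; elim: m U => // m IHm U leU.
rewrite leq_eqVlt => /orP[/eqP e|ltU]; first by rewrite -e; apply: HR.
have H v : v \in U -> #|U|.-1 * #|U|.-2 <= w * degsum G (U :\ v).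
  move=> vU; have e : #|U :\ v| = #|U|.-1 by rewrite (cardsD1 v U) vU.
  by rewrite -e; apply: IHm; lia.
have : #|U| * (#|U|.-1 * #|U|.-2) <= w * \sum_(v in U) degsum G (U :\ v).
  by rewrite -sum_nat_const big_distrr; apply: leq_sum.
have := degsumD1 U; move: (\sum_(v in U) _) => S.
move: ltU; case: #|U| => [|[|[|u]]] //=; try lia.
move: (degsum G U) => d _ e le; rewrite -(leq_pmul2l (ltn0Sn u)).
have eS : S = u.+1 * d by lia.
by move: le; rewrite eS; lia.
Qed.

Lemma exists_large_link R w U : 1 < R ->
  (forall U', #|U'| = R -> R * R.-1 <= w * degsum G U') ->
  R <= #|U| -> exists2 v, v \in U & #|U| <= w.*2 * #|link G U v|.
Proof.
move=> R1 HR leU; apply: contrapT => nex.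
have H v : v \in U -> w.*2 * #|link G U v| <= #|U|.-1.
  by move=> vU; rewrite leqNgt; apply/negP => lt; apply: nex; exists v => //; lia.
have := degsum_supersaturation R1 HR leU.
have : w.*2 * degsum G U <= #|U| * #|U|.-1.
  by rewrite -sum_nat_const big_distrr; apply: leq_sum.
nia.
Qed.

Lemma containers R D s A :
  (forall U, R <= #|U| -> exists2 v, v \in U & #|U| <= D * #|link G U v|) ->
  #|A| * D.-1 ^ s < R * D ^ s ->
  exists cs : seq {set T}, [/\ size cs <= #|A|.+1 ^ s, all (fun C : {set _} => #|C| < R) cs &
    forall I : {set T}, I \subset A -> independent G I -> has (fun C : {set _} => I \subset C) cs].
Proof.
move=> HU; have [m] := ubnP #|A|; elim: m A s => // m IHm A s leA lts.
have [ltA|leRA] := ltnP #|A| R.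
  exists [:: A]; rewrite /= ltA expn_gt0; split=> // I sIA _.
  by rewrite sIA.
have [v vA vD] := HU A leRA.
have A_gt0 : 0 < #|A| by apply/card_gt0P; exists v.
have e1 : #|A| = #|A :\ v|.+1 by rewrite (cardsD1 v A) vA.
case: s lts => [|s] lts; first by move: lts; rewrite !expn0; lia.
pose A' := A :\: link G A v.
have e2 : #|A| = #|link G A v| + #|A'|.
  rewrite -(cardsID (link G A v) A); congr (#|pred_of_set _| + _).
  by apply/setIidPr/subsetP => x; rewrite inE => /andP[].
have D_gt0 : 0 < D by case: (posnP D) => // D0; rewrite D0 in vD; lia.
have [||cs1 [sz1 all1 H1]] := IHm (A :\ v) s.+1; first by lia.
  by apply: leq_ltn_trans lts; rewrite leq_mul2r; apply/orP; right; lia.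
have [||cs2 [sz2 all2 H2]] := IHm A' s; first by nia.
  have : D * #|A'| <= #|A| * D.-1 by nia.
  move: lts; rewrite !expnS => lts le.
  rewrite -(ltn_pmul2l D_gt0) mulnA; apply: leq_ltn_trans (_ : #|A| * D.-1 * D.-1 ^ s < _).
    by rewrite leq_mul2r le orbT.
  by rewrite -mulnA (leq_trans lts) // mulnCA.
exists (cs1 ++ cs2); rewrite size_cat all_cat all1 all2; split=> // [|I sIA iI].
  have mono k l : k <= l -> k ^ s <= l ^ s by case: (s) => // s' kl; rewrite leq_exp2r.
  apply: leq_trans (leq_add sz1 sz2) _; rewrite -e1 [leqRHS]expnS mulSn [leqRHS]addnC.
  by rewrite expnS leq_add ?leq_mul2l ?mono ?orbT //; lia.
rewrite has_cat; have [vI|vI] := boolP (v \in I); apply/orP; [right | left].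
  apply: H2 => //; apply/subsetP => x xI; rewrite inE (subsetP sIA) // andbT inE.
  by rewrite negb_and (independentP _ _ iI) ?orbT.
by apply: H1 => //; rewrite subsetD1 sIA.
Qed.

End Containers.

Section RandomMap.
Variables (L : finType) (G : sgraph L).
Hypothesis K4_free : forall x y z t : L,
  [/\ G x y, G x z & G x t] -> [/\ G y z, G y t & G z t] -> False.

Definition pullback_blue (M : nat) (f : 'I_M -> L) : rel 'I_M := fun i j => ~~ G (f i) (f j).
Lemma pullback_blue_sym (M : nat) (f : 'I_M -> L) : symmetric (pullback_blue f).
Proof. by move=> i j; rewrite /pullback_blue adj_sym. Qed.
Definition pullback (M : nat) (f : 'I_M -> L) := Coloring (pullback_blue_sym f).

Lemma card_maps_into (N : nat) (Y : {set 'I_N}) (C : {set L}) :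
  #|[set f : {ffun 'I_N -> L} | f @: Y \subset C]| = #|C| ^ #|Y| * #|L| ^ (N - #|Y|).
Proof.
pose F i : pred L := [pred x | (i \in Y) ==> (x \in C)].
have -> : #|[set f : {ffun 'I_N -> L} | f @: Y \subset C]| = #|family F|.
  apply: eq_card => f; rewrite inE; apply/subsetP/familyP => [sf i|Ff _ /imsetP[i iY ->]].
    by apply/implyP => iY; apply: sf; apply: imset_f.
  by have /implyP := Ff i; apply.
rewrite card_family foldrE big_map big_enum /= (bigID (mem Y)) /=; congr (_ * _).
  by rewrite -prod_nat_const; apply: eq_bigr => i iY; apply: eq_card => x; rewrite !inE iY.
have -> : N - #|Y| = #|~: Y| by have := cardsC Y; rewrite card_ord; lia.
rewrite -prod_nat_const; apply: eq_big => [i|i /negbTE iY]; first by rewrite inE.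
by apply: eq_card => x; rewrite !inE iY.
Qed.

Lemma ramsey_lower (cs : seq {set L}) R n M :
  all (fun C : {set _} => #|C| < R) cs ->
  (forall I : {set L}, independent G I -> has (fun C : {set _} => I \subset C) cs) ->
  'C(M, n) * size cs * R ^ n < #|L| ^ n -> M < ramsey 4 n.
Proof.
move=> csR csI lt; rewrite /ramsey; case: ex_minnP => N /asboolP HN _.
rewrite ltnNge; apply/negP => leNM.
have {}lt : 'C(N, n) * size cs * R ^ n < #|L| ^ n.
  apply: leq_ltn_trans lt; rewrite !leq_mul2r; apply/orP; right; apply/orP; right.
  exact: leq_bin2l.
have H (f : {ffun 'I_N -> L}) : exists Y : {set 'I_N}, #|Y| = n /\ independent G (f @: Y).
  have [[X [cX iX]]|[Y [cY iY]]] := HN (pullback f).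
    exfalso.
    have Gf i j : i \in X -> j \in X -> i != j -> G (f i) (f j).
      move=> iX' jX ij; have := independentP _ _ iX i j iX' jX.
      by rewrite /= /pullback_blue ij /= negbK.
    have := enum_uniq X; have := mem_enum X; have := cardE X; rewrite cX.
    case: (enum X) => [|x [|y [|z [|t []]]]] //= _ memX.
    rewrite !inE !negb_or => /and4P[/and3P[xy xz xt] /andP[yz yt] zt _].
    have inX i : i \in [:: x; y; z; t] -> i \in X by rewrite memX.
    by apply: (K4_free (x := f x) (y := f y) (z := f z) (t := f t));
      split; apply: Gf => //; apply: inX; rewrite !inE eqxx ?orbT.
  exists Y; split=> //; apply/independentP => _ _ /imsetP[i iY' ->] /imsetP[j jY ->].
  have := independentP _ _ iY i j iY' jY; rewrite /= /pullback_blue negb_and !negbK.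
  by case/orP=> [/eqP->|//]; rewrite adj_irrefl.
have [ltNn|leNn] := ltnP N n.
  have L_gt0 : 0 < #|L| by case: #|L| lt => //; rewrite exp0n //; lia.
  have /card_gt0P[x _] := L_gt0.
  have [Y [cY _]] := H [ffun=> x].
  by have := max_card (mem Y); rewrite card_ord cY leqNgt ltNn.
have : #|{ffun 'I_N -> L}| <= 'C(N, n) * size cs * R ^ n * #|L| ^ (N - n).
  have -> : #|{ffun 'I_N -> L}| = #|\bigcup_(Y : {set 'I_N} | #|Y| == n)
     \bigcup_(C <- cs) [set f : {ffun 'I_N -> L} | f @: Y \subset C]|.
    rewrite -cardsT; congr (#|pred_of_set _|); apply/esym/setP => f; rewrite !inE.
    have [Y [cY iY]] := H f; apply/bigcupP; exists Y; first by rewrite cY.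
    have /hasP[C Ccs sC] := csI _ iY.
    by rewrite (big_rem C) //= in_setU inE sC.
  apply: leq_trans (leq_card_bigcup _ _ _) _.
  apply: leq_trans (_ : \sum_(Y : {set 'I_N} | #|Y| == n) size cs * R ^ n * #|L| ^ (N - n) <= _).
    apply: leq_sum => Y /eqP cY.
    apply: leq_trans (_ : \sum_(C <- cs) R ^ n * #|L| ^ (N - n) <= _); last first.
      by rewrite big_const_seq count_predT iter_addn_0 mulnC mulnA.
    rewrite big_seq [leqRHS]big_seq; apply: leq_trans (leq_card_bigcup _ _ _) _.
    apply: leq_sum => C Ccs; rewrite card_maps_into cY leq_mul2r; apply/orP; right.
    by case: (n) => // n'; rewrite leq_exp2r // ltnW // (allP csR).
  rewrite (eq_bigl (fun Y => Y \in [set Z : {set 'I_N} | #|Z| == n])) => [|Y]; last by rewrite inE.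
  by rewrite sum_nat_const card_draws card_ord !mulnA.
rewrite card_ffun card_ord -{1}(subnKC leNn) expnD.
have L_gt0 : 0 < #|L|.
  have : has (fun C : {set L} => set0 \subset C) cs.
    by apply: csI; apply/independentP => x y; rewrite inE.
  case: (posnP #|L|) lt => // ->; case: (n) => [|n']; last by rewrite exp0n.
  by case: (cs) => //= C cs'; rewrite bin0 expn0; lia.
by rewrite leq_pmul2r ?expn_gt0 ?L_gt0 // leqNgt lt.
Qed.

End RandomMap.

(** * Random bipartitions of the pencils of a partial linear space *)

Section Incidence.
Variables (P L : finType) (inc : P -> L -> bool).
Implicit Types (p : P) (l : L) (w : {set P * L}) (U : {set L}).

Hypothesis meet_once : forall p p' l l',
  inc p l -> inc p l' -> inc p' l -> inc p' l' -> l != l' -> p = p'.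

(* The set [w] colours each incident pair (point, line) in two colours. *)
Definition split_rel w : rel L := fun l l' =>
  [exists p, [&& inc p l, inc p l' & ((p, l) \in w) != ((p, l') \in w)]].

Lemma split_sym w : symmetric (split_rel w).
Proof. by move=> l l'; apply: eq_existsb => p; rewrite andbCA eq_sym. Qed.

Lemma split_irrefl w : irreflexive (split_rel w).
Proof. by move=> l; apply/existsP => -[p]; rewrite eqxx !andbF. Qed.

Definition split_graph w : sgraph L := SGraph (@split_sym w) (@split_irrefl w).

Lemma split_graphP w l l' : reflect
  (exists p, [/\ inc p l, inc p l' & ((p, l) \in w) != ((p, l') \in w)]) (split_graph w l l').
Proof. by apply: (iffP existsP) => -[p /and3P H]; exists p. Qed.

Lemma split_neq w l l' : split_graph w l l' -> l != l'.
Proof. by apply: contraTneq => ->; rewrite adj_irrefl. Qed.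

Lemma split_triangle w l1 l2 l3 p : split_graph w l1 l2 -> split_graph w l1 l3 ->
  split_graph w l2 l3 -> inc p l1 -> inc p l2 -> ~~ inc p l3.
Proof.
move=> e12 e13 e23 p1 p2; apply/negP => p3.
have [[n12 n13] n23] := (split_neq e12, split_neq e13, split_neq e23).
have /split_graphP[x [x1 x2 +]] := e12; rewrite (meet_once x1 x2 p1 p2 n12).
have /split_graphP[y [y1 y3 +]] := e13; rewrite (meet_once y1 y3 p1 p3 n13).
have /split_graphP[z [z2 z3 +]] := e23; rewrite (meet_once z2 z3 p2 p3 n23).
by case: (_ \in w); case: (_ \in w); case: (_ \in w).
Qed.

(* O'Nan's condition: no four lines meet in six distinct points. *)
Hypothesis onan_free : forall l1 l2 l3 l4 p12 p13 p14 p23 p24 p34,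
  [/\ inc p12 l1, inc p12 l2, inc p13 l1 & inc p13 l3] ->
  [/\ inc p14 l1, inc p14 l4, inc p23 l2 & inc p23 l3] ->
  [/\ inc p24 l2, inc p24 l4, inc p34 l3 & inc p34 l4] ->
  [/\ ~~ inc p12 l3, ~~ inc p13 l2 & ~~ inc p12 l4] -> ~~ inc p13 l4 -> ~~ inc p23 l4 -> False.

Lemma split_K4_free w l1 l2 l3 l4 (G := split_graph w) :
  [/\ G l1 l2, G l1 l3 & G l1 l4] -> [/\ G l2 l3, G l2 l4 & G l3 l4] -> False.
Proof.
move=> [e12 e13 e14] [e23 e24 e34].
have /split_graphP[p12 [a1 a2 _]] := e12; have /split_graphP[p13 [b1 b3 _]] := e13.
have /split_graphP[p14 [c1 c4 _]] := e14; have /split_graphP[p23 [d2 d3 _]] := e23.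
have /split_graphP[p24 [f2 f4 _]] := e24; have /split_graphP[p34 [g3 g4 _]] := e34.
apply: (onan_free (l1 := l1) (l2 := l2) (l3 := l3) (l4 := l4) (p12 := p12) (p13 := p13)
  (p14 := p14) (p23 := p23) (p24 := p24) (p34 := p34)) => //; first split.
- exact: split_triangle e12 e13 e23 _ _.
- by apply: split_triangle e13 e12 _ b1 b3; rewrite adj_sym.
- exact: split_triangle e12 e14 e24 _ _.
- exact: split_triangle e13 e14 e34 _ _.
- exact: split_triangle e23 e24 e34 _ _.
Qed.

Definition mono w U : {set P} :=
  [set p | [forall l in U, forall l' in U,
     inc p l ==> inc p l' ==> (((p, l) \in w) == ((p, l') \in w))]].

Lemma monoP w U p l l' : p \in mono w U -> l \in U -> l' \in U -> inc p l -> inc p l' ->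
  ((p, l) \in w) = ((p, l') \in w).
Proof.
rewrite inE => /forall_inP H lU l'U pl pl'.
by have /forall_inP/(_ _ l'U) := H l lU; rewrite pl pl' => /eqP.
Qed.

Lemma card_split_link w U l : l \in U ->
  #|[set p | inc p l & p \notin mono w U]| <= #|link (split_graph w) U l|.
Proof.
move=> lU; set A := finset _.
pose g p := odflt l [pick l' in U | inc p l' && (((p, l) \in w) != ((p, l') \in w))].
have gP p : p \in A -> [/\ g p \in U, inc p (g p) & ((p, l) \in w) != ((p, g p) \in w)].
  rewrite inE => /andP[pl pM]; rewrite /g; case: pickP => [l' /and3P[]//|none].
  case/negP: pM; rewrite inE.
  have same l' : l' \in U -> inc p l' -> ((p, l') \in w) = ((p, l) \in w).
    by move=> l'U pl'; have := none l'; rewrite /= l'U pl' /= => /negbFE/eqP.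
  apply/forall_inP => l1 l1U; apply/forall_inP => l2 l2U.
  by apply/implyP => pl1; apply/implyP => pl2; rewrite !same.
have inj_g : {in A &, injective g}.
  move=> p p' pA p'A e; have [_ pg ne] := gP _ pA; have [_ p'g _] := gP _ p'A.
  have [pl p'l] : inc p l /\ inc p' l by move: pA p'A; rewrite !inE => /andP[-> _] /andP[-> _].
  apply: (meet_once pl pg p'l); first by rewrite e.
  by apply: contraNneq ne => <-.
rewrite -(card_in_imset inj_g); apply/subset_leq_card/subsetP => _ /imsetP[p pA ->].
have [gU pg ne] := gP _ pA; rewrite inE gU /=; apply/split_graphP; exists p; split=> //.
by move: pA; rewrite inE => /andP[].
Qed.

Definition flags U (M : {set P}) : {set P * L} :=
  [set x | [&& x.1 \in M, x.2 \in U & inc x.1 x.2]].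

Lemma card_flags U (M : {set P}) : #|flags U M| = \sum_(l in U) #|[set p in M | inc p l]|.
Proof.
rewrite -sum1_card (eq_bigr (fun l => \sum_(p | (p \in M) && inc p l) 1)); last first.
  by move=> l _; rewrite -sum1_card; apply: eq_bigl => p; rewrite inE.
rewrite (exchange_big_dep (mem M)) => [|l p _ /andP[]//]; rewrite pair_big_dep /=.
by apply: eq_bigl => -[p l]; rewrite inE /=; case: (p \in M).
Qed.

Lemma degsum_flags w U q : (forall l, q <= #|[set p | inc p l]|) ->
  #|U| * q <= degsum (split_graph w) U + #|flags U (mono w U)|.
Proof.
move=> lq; rewrite card_flags /degsum -big_split /= -sum_nat_const.
apply: leq_sum => l lU; apply: leq_trans (lq l) _.
rewrite -(cardsID (mono w U)) addnC leq_add //.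
  apply: leq_trans (card_split_link w lU); apply/subset_leq_card/subsetP => p.
  by rewrite !inE => /andP[-> ->].
by apply/subset_leq_card/subsetP => p; rewrite !inE andbC.
Qed.

Lemma card_mono_colorings U (M : {set P}) :
  #|[set w | M \subset mono w U]| * 2 ^ #|flags U M| <= 2 ^ (#|P| * #|L| + #|P|).
Proof.
(* Keep one flag through each point: if the points of [M] are monochromatic,
   the colours of the kept flags determine those on [F]. *)
pose F := [set x in flags U M | Some x.2 != [pick l in U | inc x.1 l]].
have leF : #|flags U M| <= #|F| + #|P|.
  rewrite -(cardsID F (flags U M)); apply: leq_add.
    by apply/subset_leq_card/subsetIr.
  rewrite -(@card_in_imset _ _ fst); first by rewrite max_card.
  move=> [p l] [p' l'] /=; rewrite !inE /= => /andP[H1 f1] /andP[H2 f2] e; move: e H2 f2 => <-.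
  move: H1; rewrite f1 /= negbK => /eqP e1 + f2; rewrite f2 /= negbK => /eqP.
  by rewrite -e1 => -[->].
have cw : #|[set w | M \subset mono w U]| <= 2 ^ #|~: F|.
  rewrite -card_powerset -(@card_in_imset _ _ (fun w => w :&: ~: F)); last first.
    move=> w w'; rewrite !inE => sM sM' e; apply/setP => -[p l].
    have eF x : x \notin F -> (x \in w) = (x \in w').
      by move=> xF; have /setP/(_ x) := e; rewrite !in_setI !in_setC xF !andbT.
    have [inF|/eF//] := boolP ((p, l) \in F).
    move: inF; rewrite inE => /andP[]; rewrite inE /= => /and3P[pM lU pl].
    case E: [pick l1 in U | inc p l1] => [l0|]; last first.
      by move: E; case: pickP => // /(_ l); rewrite /= lU pl.
    have [l0U pl0] : l0 \in U /\ inc p l0 by move: E; case: pickP => // l1 /andP[? ?] [<-].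
    have e0 : ((p, l0) \in w) = ((p, l0) \in w').
      by apply: eF; rewrite inE /= E eqxx andbF.
    move=> _; rewrite (monoP (subsetP sM _ pM) lU l0U pl pl0) e0.
    by rewrite (monoP (subsetP sM' _ pM) lU l0U pl pl0).
  by apply/subset_leq_card/subsetP => _ /imsetP[w _ ->]; rewrite inE subsetIr.
apply: leq_trans (leq_mul cw (leqnn _)) _; rewrite -expnD leq_exp2l //.
have := cardsC F; rewrite card_prod; lia.
Qed.

Lemma good_coloring R q h : (forall l, q <= #|[set p | inc p l]|) -> h.*2 <= R * q ->
  'C(#|L|, R) * 2 ^ (#|P|.*2) < 2 ^ h ->
  exists w, forall U : {set L}, #|U| = R -> h <= degsum (split_graph w) U.
Proof.
move=> lq hR lt; apply: contrapT => nex.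
have bad w : exists2 U : {set L}, #|U| = R & degsum (split_graph w) U < h.
  apply: contrapT => nU; apply: nex; exists w => U cU; rewrite leqNgt.
  by apply/negP => ltU; apply: nU; exists U.
pose B U (M : {set P}) := [set w | M \subset mono w U].
have cover : [set: {set P * L}] \subset
    \bigcup_(U in [set U : {set L} | #|U| == R]) \bigcup_(M : {set P} | h <= #|flags U M|) B U M.
  apply/subsetP => w _; have [U cU ltU] := bad w.
  apply/bigcupP; exists U; first by rewrite inE cU.
  apply/bigcupP; exists (mono w U); last by rewrite inE.
  have := degsum_flags w U lq; rewrite cU; lia.
have cB U M : h <= #|flags U M| -> #|B U M| * 2 ^ h <= 2 ^ (#|P| * #|L| + #|P|).
  move=> le; apply: leq_trans (card_mono_colorings U M).
  by rewrite leq_mul2l leq_exp2l // le orbT.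
have := subset_leq_card cover; rewrite -powersetT card_powerset cardsT card_prod => le.
have cP : #|{: {set P}}| = 2 ^ #|P| by rewrite -[LHS]cardsT -powersetT card_powerset cardsT.
have : 2 ^ (#|P| * #|L|) * 2 ^ h <= 'C(#|L|, R) * (2 ^ #|P| * 2 ^ (#|P| * #|L| + #|P|)).
  apply: leq_trans (_ : (\sum_(U in [set U : {set L} | #|U| == R])
     \sum_(M : {set P} | h <= #|flags U M|) #|B U M|) * 2 ^ h <= _).
    rewrite leq_mul2r; apply/orP; right; apply: leq_trans le _.
    apply: leq_trans (leq_card_bigcup _ _ _) _; apply: leq_sum => U _.
    exact: leq_card_bigcup.
  rewrite big_distrl -card_draws -[leqRHS]sum_nat_const /=; apply: leq_sum => U _.
  rewrite big_distrl -cP -[leqRHS]sum_nat_const /= big_mkcond; apply: leq_sum => M _.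
  by case: ifP => // /cB.
rewrite !expnD.
have : 0 < 2 ^ (#|P| * #|L|) by rewrite expn_gt0.
move: lt; rewrite -addnn expnD; nia.
Qed.

End Incidence.

(** * Hermitian unitals *)

Section Hermitian.
Local Open Scope ring_scope.
Variables (F : fieldType) (conj : F -> F).
Hypothesis conjD : {morph conj : x y / x + y}.
Hypothesis conjM : {morph conj : x y / x * y}.
Hypothesis conjK : involutive conj.
Implicit Types (u v w : F * F) (l : F * F).

Definition isotropic u := u.2 + conj u.2 == u.1 * conj u.1.
Definition on u l := u.2 == l.1 * u.1 + l.2.
Definition herm u v := u.2 + conj v.2 - u.1 * conj v.1.
Definition eval l u := u.2 - l.1 * u.1 - l.2.

Lemma conj0 : conj 0 = 0.
Proof. by apply: (addrI (conj 0)); rewrite -conjD !addr0. Qed.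

Lemma conjN : {morph conj : x / - x}.
Proof. by move=> x; apply: (addrI (conj x)); rewrite -conjD !subrr conj0. Qed.

Lemma conjB : {morph conj : x y / x - y}.
Proof. by move=> x y; rewrite conjD conjN. Qed.

Let conjE := (conjB, conjD, conjM, conjN, conjK).

Lemma meet_once_affine u v l l' :
  on u l -> on u l' -> on v l -> on v l' -> l != l' -> u = v.
Proof.
move: u v l l' => [x y] [x' y'] [m b] [m' b']; rewrite /on /= => /eqP-> /eqP e1 /eqP-> /eqP e2 ne.
have e : (m - m') * (x - x') = 0.
  have -> : (m - m') * (x - x') = (m * x + b - (m' * x + b')) - (m * x' + b - (m' * x' + b')) by ring.
  by rewrite e1 e2 !subrr.
have [mm|nmm] := eqVneq m m'.
  by case/eqP: ne; move: e1; rewrite mm => /addrI ->.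
move/eqP: e; rewrite mulf_eq0 !subr_eq0 (negbTE nmm) /= => /eqP exx.
by rewrite exx.
Qed.

(* The point of the secant [uv] lying on [l4] is [f v * u - f u * v] in
   homogeneous coordinates, where [f = eval l4]; it is isotropic. *)
Lemma isotropic_on_secant l l4 u v w (f := eval l4) :
  isotropic u -> isotropic v -> isotropic w ->
  on u l -> on v l -> on w l -> on w l4 ->
  f v * conj (f u) * herm u v + f u * conj (f v) * conj (herm u v) = 0.
Proof.
move: l l4 u v w @f => [m b] [m4 b4] [xu yu] [xv yv] [xw yw] /=.
rewrite /isotropic /on /eval /herm /= => /eqP iu /eqP iv /eqP iw /eqP eu /eqP ev /eqP ew /eqP e4.
have fE x y : y = m * x + b -> y - m4 * x - b4 = (m - m4) * (x - xw).
  move=> ->; have -> : b4 = m * xw + b - m4 * xw by rewrite -ew e4 addrC addKr.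
  by ring.
rewrite (fE _ _ eu) (fE _ _ ev) eu ev !conjE; move: iu iv iw; rewrite eu ev ew !conjE.
move: (conj m) (conj b) (conj m4) (conj xu) (conj xv) (conj xw) => m' b' m4' xu' xv' xw'.
pose rho := m * m' + b + b'.
pose A := xu - m'; pose A' := xu' - m; pose B := xv - m'; pose B' := xv' - m.
pose C := xw - m'; pose C' := xw' - m.
move=> iu iv iw.
have du : A * A' - rho = 0 by rewrite -(subrr (xu * xu')) -{2}iu /A /A' /rho; ring.
have dv : B * B' - rho = 0 by rewrite -(subrr (xv * xv')) -{2}iv /B /B' /rho; ring.
have dw : C * C' - rho = 0 by rewrite -(subrr (xw * xw')) -{2}iw /C /C' /rho; ring.
transitivity ((m - m4) * (m' - m4') *
  ((C * C' - rho) * (rho *+ 2 - A * B' - A' * B) - (A * A' - rho) * (B * B' *+ 2 - B' * C - B * C')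
   - (B * B' - rho) * (rho *+ 2 - A * C' - A' * C))).
  by rewrite /A /A' /B /B' /C /C' /rho; ring.
by rewrite du dv dw !mul0r !subrr mulr0.
Qed.

(* The Gram determinant of three isotropic vectors, which factors as
   [det * conj det] for the determinant of their coordinates. *)
Lemma herm_gram u v w
  (d := (v.1 - u.1) * (w.2 - u.2) - (w.1 - u.1) * (v.2 - u.2)) :
  isotropic u -> isotropic v -> isotropic w ->
  herm u v * herm v w * herm w u + conj (herm u v * herm v w * herm w u) = d * conj d.
Proof.
move=> /eqP iu /eqP iv /eqP iw; rewrite /d /herm !conjE.
have {iu}-> : conj u.2 = u.1 * conj u.1 - u.2 by rewrite -iu addrC addKr.
have {iv}-> : conj v.2 = v.1 * conj v.1 - v.2 by rewrite -iv addrC addKr.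
have {iw}-> : conj w.2 = w.1 * conj w.1 - w.2 by rewrite -iw addrC addKr.
ring.
Qed.

(* The four lines form a complete quadrilateral: by Menelaus the three
   relations of [isotropic_on_secant] multiply to the vanishing of the Gram
   determinant of the triangle [p12 p13 p23]. *)
Lemma onan_free_unital l1 l2 l3 l4 p12 p13 p14 p23 p24 p34 :
  [/\ isotropic p12, isotropic p13 & isotropic p14] ->
  [/\ isotropic p23, isotropic p24 & isotropic p34] ->
  [/\ on p12 l1, on p12 l2, on p13 l1 & on p13 l3] ->
  [/\ on p14 l1, on p14 l4, on p23 l2 & on p23 l3] ->
  [/\ on p24 l2, on p24 l4, on p34 l3 & on p34 l4] ->
  [/\ ~~ on p12 l3, ~~ on p13 l2 & ~~ on p12 l4] -> ~~ on p13 l4 -> ~~ on p23 l4 -> False.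
Proof.
move=> [i12 i13 i14] [i23 i24 i34] [a1 a2 b1 b3] [c1 c4 d2 d3] [e2 e4 g3 g4].
move=> [n12 n132 m12] m13 m23.
pose f := eval l4.
have f_neq0 u : ~~ on u l4 -> f u != 0.
  by apply: contraNneq => /eqP; rewrite /f /eval -addrA -opprD subr_eq0.
have conj_neq0 x : x != 0 -> conj x != 0.
  by apply: contraNneq => e; rewrite -(conjK x) e conj0.
have r1 := isotropic_on_secant i12 i13 i14 a1 b1 c1 c4.
have r2 := isotropic_on_secant i13 i23 i34 b3 d3 g3 g4.
have r3 := isotropic_on_secant i23 i12 i24 d2 a2 e2 e4.
have gram := herm_gram i12 i13 i23.
move: r1 r2 r3 gram; rewrite -/(f _) -/(f _) -/(f _).
set d := (X in _ = X * conj X -> _).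
have d_neq0 : d != 0.
  have -> : d = (p23.1 - p13.1) * (p12.2 - l3.1 * p12.1 - l3.2).
    by rewrite /d (eqP b3) (eqP d3); ring.
  rewrite mulf_neq0 //; last by apply: contraNneq n12 => /eqP; rewrite -addrA -opprD subr_eq0.
  rewrite subr_eq0; apply: contraNneq n132 => e.
  by rewrite /on -e (eqP b3) -e -(eqP d3) (eqP d2).
have := mulf_neq0 (mulf_neq0 (f_neq0 _ m12) (f_neq0 _ m13)) (f_neq0 _ m23).
have := mulf_neq0 (mulf_neq0 (conj_neq0 _ (f_neq0 _ m12)) (conj_neq0 _ (f_neq0 _ m13)))
  (conj_neq0 _ (f_neq0 _ m23)).
have := mulf_neq0 d_neq0 (conj_neq0 _ d_neq0).
rewrite !conjM.
move: (f p12) (f p13) (f p23) (conj (f p12)) (conj (f p13)) (conj (f p23)).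
move: (herm _ _) (herm _ _) (herm _ _) (conj (herm _ _)) (conj (herm _ _)) (conj (herm _ _)).
move=> g a b g' a' b' x y z x' y' z' dd xyz' xyz r1 r2 r3 gram.
suff /eqP : x * y * z * (x' * y' * z') * (d * conj d) = 0.
  by apply/negP/mulf_neq0 => //; apply: mulf_neq0.
  rewrite -gram; transitivity ((y * x' * b + x * y' * b') * (z * y' * a) * (x * z' * g)
    - (x * y' * b') * (z * y' * a + y * z' * a') * (x * z' * g)
    + (x * y' * b') * (y * z' * a') * (x * z' * g + z * x' * g')); first by ring.
  by rewrite r1 r2 r3 !(mul0r, mulr0) subr0 addr0.
Qed.

End Hermitian.

Section FiniteField.
Local Open Scope ring_scope.
Variables (F : finFieldType) (p q k : nat).
Hypotheses (pF : p \in [pchar F]) (eq_q : q = (p ^ k)%N) (cardF : #|F| = (q ^ 2)%N).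

Definition hconj (x : F) := x ^+ q.

Lemma q_gt1 : (1 < q)%N.
Proof. by have := finNzRing_gt1 F; rewrite cardF; case: q => [|[|]]. Qed.

Lemma hconjD : {morph hconj : x y / x + y}.
Proof.
move=> x y; rewrite /hconj exprDn_pchar // (eq_pnat _ (pcharf_eq pF)) eq_q.
by rewrite pnatX pnat_id ?orbT // (pcharf_prime pF).
Qed.

Lemma hconjM : {morph hconj : x y / x * y}.
Proof. by move=> x y; rewrite /hconj exprMn. Qed.

Lemma hconjK : involutive hconj.
Proof. by move=> x; rewrite /hconj -exprM mulnn -cardF expf_card. Qed.

Lemma card_roots_le (r : {poly F}) n :
  r != 0 -> (size r <= n.+1)%N -> (#|[set x | root r x]| <= n)%N.
Proof.
move=> r0 szr; have := max_poly_roots (rs := enum [set x | root r x]) r0.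
rewrite -cardE enum_uniq => /(_ _ isT) H; rewrite -ltnS (leq_trans _ szr) // H //.
by apply/allP => x; rewrite mem_enum inE.
Qed.

Lemma card_trace_fiber c : (#|[set y : F | (y + hconj y)%R == c]| <= q)%N.
Proof.
have sz : size ('X^q + ('X - c%:P) : {poly F}) = q.+1.
  by rewrite size_polyDl size_polyXn // size_XsubC ltnS q_gt1.
apply: leq_trans (card_roots_le (r := 'X^q + ('X - c%:P)) (n := q) _ _); last by rewrite sz.
  apply/subset_leq_card/subsetP => y; rewrite !inE => /eqP <-.
  by rewrite rootE !hornerE subr_eq0 addrC.
by rewrite -size_poly_eq0 sz.
Qed.

Lemma card_norm_fiber_le c : (#|[set x : F | (x * hconj x)%R == c]| <= q.+1)%N.
Proof.
have sz : size ('X^(q.+1) - c%:P : {poly F}) = q.+2 by rewrite size_XnsubC.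
apply: leq_trans (card_roots_le (r := 'X^(q.+1) - c%:P) (n := q.+1) _ _); last by rewrite sz.
  by apply/subset_leq_card/subsetP => y; rewrite !inE rootE !hornerE /hconj -exprS subr_eq0.
by rewrite -size_poly_eq0 sz.
Qed.

Lemma card_fixed_neq0 : (#|[set c : F | (c != 0)%R && (hconj c == c)]| <= q.-1)%N.
Proof.
have q1 : (0 < q.-1)%N by have := q_gt1; lia.
have sz : size ('X^(q.-1) - 1%:P : {poly F}) = q by rewrite size_XnsubC //; have := q_gt1; lia.
apply: leq_trans (card_roots_le (r := 'X^(q.-1) - 1%:P) (n := q.-1) _ _); last by rewrite sz; lia.
  apply/subset_leq_card/subsetP => y; rewrite !inE => /andP[y0 /eqP e].
  rewrite rootE !hornerE subr_eq0; apply/eqP/(mulfI y0); rewrite -exprS mulr1.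
  by rewrite -[in RHS]e /hconj; congr (_ ^+ _); have := q_gt1; lia.
by rewrite -size_poly_eq0 sz; have := q_gt1; lia.
Qed.

Lemma card_norm_fiber_ge c : c != 0 -> hconj c = c ->
  (q < #|[set x : F | (x * hconj x)%R == c]|)%N.
Proof.
move=> c0 cc; pose K := [set c : F | (c != 0) && (hconj c == c)].
have cK : c \in K by rewrite inE c0 cc eqxx.
have : (#|[set~ (0%R : F)]| <= \sum_(d in K) #|[set x : F | (x * hconj x)%R == d]|)%N.
  rewrite -sum1_card (partition_big (fun x => x * hconj x) (mem K)) => [|x]; last first.
    rewrite !inE => x0; rewrite hconjM hconjK mulrC eqxx andbT.
    by rewrite mulf_neq0 // /hconj expf_neq0.
  apply: leq_sum => d _; rewrite sum1_card; apply/subset_leq_card/subsetP => x.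
  by rewrite unfold_in !inE => /andP[].
rewrite cardsC1 cardF (bigD1 c) //= => le.
have : (\sum_(d in K | d != c) #|[set x : F | (x * hconj x)%R == d]| <= q.-2 * q.+1)%N.
  apply: leq_trans (_ : \sum_(d in K :\ c) q.+1 <= _)%N.
    rewrite [leqRHS](eq_bigl (fun d => (d \in K) && (d != c))) => [|d]; last first.
      by rewrite in_setD1 andbC.
    by apply: leq_sum => d _; apply: card_norm_fiber_le.
  rewrite sum_nat_const leq_mul2r; apply/orP; right.
  have := card_fixed_neq0; rewrite -/K (cardsD1 c K) cK => h.
  by rewrite -ltnS; apply: leq_trans h _; lia.
move=> le2; rewrite ltnNge; apply/negP => le3.
have := leq_trans le (leq_add le3 le2); rewrite -mulnn; have := q_gt1.
by case: (q) => [|[|n]] //=; lia.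
Qed.

Definition upoint := {u : F * F | isotropic hconj u}.
Definition secant (l : F * F) := l.1 * hconj l.1 + l.2 + hconj l.2 != 0.
Definition uline := {l : F * F | secant l}.
Definition uinc (u : upoint) (l : uline) := on (val u) (val l).

Lemma card_pair_le (A : pred (F * F)) n :
  (forall x, #|[set y | A (x, y)]| <= n)%N -> (#|[set u | A u]| <= q ^ 2 * n)%N.
Proof.
move=> H; rewrite -cardF -sum_nat_const -sum1_card (partition_big fst xpredT) //=.
apply: leq_sum => x _; apply: leq_trans (H x); rewrite sum1_card.
apply: leq_trans (_ : #|[set (x, y) | y in [set y | A (x, y)]]| <= _)%N; last first.
  by rewrite card_imset // => y y' [].
apply/subset_leq_card/subsetP => -[x' y]; rewrite unfold_in inE /= => /andP[Ay /eqP <-].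
by apply/imsetP; exists y; rewrite ?inE.
Qed.

Lemma card_upoint : (#|{: upoint}| <= q ^ 3)%N.
Proof.
rewrite card_sig -cardsE expnSr; apply: card_pair_le => x.
by apply: leq_trans (card_trace_fiber (x * hconj x)); apply/subset_leq_card/subsetP => y; rewrite !inE.
Qed.

Lemma card_uline : (q ^ 4 - q ^ 3 <= #|{: uline}| <= q ^ 4)%N.
Proof.
rewrite card_sig -cardsE; apply/andP; split; last first.
  by apply: leq_trans (max_card _) _; rewrite card_prod cardF -expnD.
have : (#|[set l | ~~ secant l]| <= q ^ 3)%N.
  rewrite expnSr; apply: (@card_pair_le (fun l => ~~ secant l)) => x.
  apply: leq_trans (card_trace_fiber (- (x * hconj x))); apply/subset_leq_card/subsetP => y.
  by rewrite !inE /secant negbK /= -addrA addrC addr_eq0.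
have := cardsC [set l | secant l]; rewrite card_prod cardF -expnD.
have -> : ~: [set l | secant l] = [set l | ~~ secant l] by apply/setP => l; rewrite !inE.
rewrite -[(2 + 2)%N]/4%N => <- le; by rewrite leq_subLR addnC leq_add2r.
Qed.

Lemma card_uinc (l : uline) : (q <= #|[set u | uinc u l]|)%N.
Proof.
case: l => -[m b] /= nz; pose rho := m * hconj m + b + hconj b.
have hrho : hconj rho = rho by rewrite /rho !hconjD hconjM !hconjK; ring.
apply: leq_trans (ltnW (card_norm_fiber_ge nz hrho)) _.
pose f x := (x + hconj m, m * (x + hconj m) + b).
have fP x : x * hconj x == rho -> isotropic hconj (f x).
  rewrite /isotropic /f /= !(hconjD, hconjM, hconjK) => /eqP e.
  apply/eqP; transitivity (x * m + hconj x * hconj m + m * hconj m + rho); first by rewrite /rho; ring.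
  by rewrite -e; ring.
have inj_f : injective f by move=> x y [/addIr].
rewrite -(card_imset _ inj_f) -[leqRHS](card_imset _ val_inj).
apply/subset_leq_card/subsetP => u /imsetP[x]; rewrite inE => /fP fx ->.
by apply/imsetP; exists (Sub (f x) fx); rewrite ?SubK // inE /uinc /= /on /=.
Qed.

End FiniteField.

(** * Comparison of the two bounds *)

Lemma ffact_leq_expn n m : n ^_ m <= n ^ m.
Proof.
elim: m => [|m IHm]; first by rewrite ffactn0.
by rewrite ffactnSr expnSr leq_mul // leq_subr.
Qed.

Lemma expn_leq_ffact n m : n ^ m <= (n + m) ^_ m.
Proof.
elim: m => [|m IHm]; first by rewrite ffactn0.
by rewrite addnS ffactSS expnS leq_mul //; lia.
Qed.

Lemma bin_leq_expn n m : 'C(n, m) <= n ^ m.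
Proof.
by apply: leq_trans (ffact_leq_expn n m); rewrite -bin_ffact leq_pmulr ?fact_gt0.
Qed.

Lemma bin_leq_exp2 n m : 'C(n, m) <= 2 ^ n.
Proof.
rewrite -[n in 'C(n, _)]card_ord -card_draws; apply: leq_trans (max_card _) _.
by rewrite -cardsT -powersetT card_powerset cardsT card_ord.
Qed.

Lemma expnn_leq_fact n : n ^ n <= 4 ^ n * n`!.
Proof.
apply: leq_trans (expn_leq_ffact n n) _; rewrite -bin_ffact leq_mul2r.
by rewrite (leq_trans (bin_leq_exp2 _ _)) ?orbT // addnn -mul2n expnM.
Qed.

Lemma bin_mul_leq a n : 0 < n -> 'C(a * n, n) <= (4 * a) ^ n.
Proof.
move=> n0; have nn : 0 < n ^ n by rewrite expn_gt0 n0.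
rewrite -(leq_pmul2r nn); apply: leq_trans (leq_mul (leqnn _) (expnn_leq_fact n)) _.
rewrite mulnCA bin_ffact !expnMn -mulnA leq_mul2l -expnMn.
by rewrite ffact_leq_expn orbT.
Qed.

Lemma expn_pred_leq D : 0 < D -> 2 * D.-1 ^ D <= D ^ D.
Proof.
case: D => [|[|d']] //= _; have := ltn0Sn d'; move: d'.+1 => d d0.
have bernoulli m : d ^ m * (d + m) <= d * d.+1 ^ m.
  elim: m => [|m IHm]; first by rewrite !expn0; lia.
  rewrite !expnS; move: IHm; move: (d ^ m) (d.+1 ^ m) => x y; nia.
have := bernoulli d.+1; move: (d ^ d.+1) (d.+1 ^ d.+1) => x y le.
by rewrite -(leq_pmul2l d0); nia.
Qed.

Lemma expn_pred_decay D m : 0 < D -> 2 ^ m * D.-1 ^ (D * m) <= D ^ (D * m).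
Proof.
move=> D0; rewrite (expnM D) (expnM D.-1) -expnMn.
by case: m => // m; rewrite leq_exp2r ?expn_pred_leq.
Qed.

Lemma ramsey4_lower k n : 16 * k < 2 ^ k -> 3 < k -> 640 * k ^ 2 * 2 ^ k <= n ->
  2 ^ (2 * k - 8) * n < ramsey 4 n.
Proof.
move=> ltk k3 len.
have k0 : 0 < 2 * k by lia.
have [F pF cF] := @pPrimePowerField 2 (2 * k) isT k0.
have [q eq_q] : {q | q = 2 ^ k} by exists (2 ^ k).
have cardF : #|F| = q ^ 2 by rewrite cF eq_q -expnM mulnC.
have q0 : 0 < q by rewrite eq_q expn_gt0.
have cP := card_upoint cardF.
have /andP[leL Lle] := card_uline cardF.
have lq : forall l, q <= #|[set u | uinc (F := F) (q := q) u l]| by exact: card_uinc pF eq_q cardF.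
have hD : {morph @hconj F q : x y / (x + y)%R} by exact: hconjD pF eq_q.
have hM := @hconjM F q; have hK : involutive (@hconj F q) by exact: hconjK.
have once : forall p p' l l', @uinc F q p l -> uinc p l' -> uinc p' l -> uinc p' l' ->
    l != l' -> p = p'.
  by move=> p p' l l' h1 h2 h3 h4 ne; apply: val_inj; apply: (meet_once_affine h1 h2 h3 h4).
have onan : forall l1 l2 l3 l4 p12 p13 p14 p23 p24 p34,
  [/\ @uinc F q p12 l1, uinc p12 l2, uinc p13 l1 & uinc p13 l3] ->
  [/\ uinc p14 l1, uinc p14 l4, uinc p23 l2 & uinc p23 l3] ->
  [/\ uinc p24 l2, uinc p24 l4, uinc p34 l3 & uinc p34 l4] ->
  [/\ ~~ uinc p12 l3, ~~ uinc p13 l2 & ~~ uinc p12 l4] -> ~~ uinc p13 l4 -> ~~ uinc p23 l4 -> False.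
  move=> l1 l2 l3 l4 p12 p13 p14 p23 p24 p34; apply: (onan_free_unital hD hM hK);
    by split; apply: valP.
set P := upoint F q in cP lq once onan *; set L := uline F q in leL Lle lq once onan *.
pose R := 8 * q ^ 2; pose h := 4 * q ^ 3.
have q4 : q ^ 4 = 2 ^ (4 * k) by rewrite eq_q -expnM mulnC.
have [||w hw] := good_coloring (R := R) (h := h) once lq.
- by rewrite /h /R !expnS expn0; lia.
- apply: leq_ltn_trans (_ : (2 ^ (4 * k)) ^ R * 2 ^ (2 * q ^ 3) < _).
    apply: leq_mul; last by rewrite leq_exp2l // -mul2n leq_mul2l; exact: cP.
    apply: leq_trans (bin_leq_expn _ _) _; rewrite leq_exp2r -?q4 // /R.
    by rewrite muln_gt0 expn_gt0 q0.
  rewrite -expnM -expnD ltn_exp2l // /h /R.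
  have : 16 * k * q ^ 2 < q * q ^ 2 by rewrite ltn_pmul2r ?expn_gt0 ?q0 // eq_q.
  by rewrite (expnS q 2); lia.
have {}hw (U : {set L}) : #|U| = R -> R * R.-1 <= 16 * q * degsum (split_graph (@uinc F q) w) U.
  move=> cU; apply: leq_trans (_ : 16 * q * h <= _); last by rewrite leq_mul2l hw ?orbT.
  apply: leq_trans (_ : R * R <= _); first by rewrite leq_mul2l leq_pred orbT.
  by rewrite /h /R !expnS expn0; lia.
have R1 : 1 < R by rewrite /R !expnS expn0; nia.
have link_large (U : {set L}) : R <= #|U| ->
    exists2 v, v \in U & #|U| <= 32 * q * #|link (split_graph (@uinc F q) w) U v|.
  move=> RU; have [v vU le] := exists_large_link R1 hw RU; exists v => //.
  by rewrite (_ : 32 * q = (16 * q).*2) //; lia.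
set D := 32 * q in link_large; pose s := D * (4 * k).
have sz1 : #|[set: L]| * D.-1 ^ s < R * D ^ s.
  have D0 : 0 < D by rewrite /D; lia.
  apply: leq_ltn_trans (_ : D ^ s < _); last by rewrite ltn_Pmull // expn_gt0 D0.
  rewrite cardsT; apply: leq_trans (_ : 2 ^ (4 * k) * D.-1 ^ s <= _).
    by rewrite leq_mul2r -q4 Lle orbT.
  exact: expn_pred_decay.
have [cs [szcs allcs hascs]] := containers link_large sz1.
apply: (ramsey_lower (split_K4_free once onan (w := w)) allcs).
  by move=> I iI; apply: hascs => //; apply: subsetT.
have n0 : 0 < n by apply: leq_trans len; rewrite !muln_gt0 !expn_gt0; lia.
have szcs2 : size cs <= 2 ^ n.
  apply: leq_trans szcs _; rewrite cardsT.
  apply: leq_trans (_ : (2 ^ (5 * k)) ^ s <= _).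
    have s0 : 0 < s by rewrite /s /D; nia.
    rewrite leq_exp2r //; apply: leq_ltn_trans Lle _; rewrite q4 ltn_exp2l //; lia.
  rewrite -expnM leq_exp2l //; apply: leq_trans len; rewrite -eq_q /s /D !expnS expn0; lia.
apply: leq_ltn_trans (_ : (4 * 2 ^ (2 * k - 8)) ^ n * 2 ^ n * R ^ n < _).
  by rewrite !leq_mul // bin_mul_leq.
rewrite -!expnMn ltn_exp2r //; apply: leq_trans leL.
have e : 2 ^ 8 * 2 ^ (2 * k - 8) = q ^ 2.
  by rewrite -expnD subnKC ?eq_q -?expnM 1?mulnC //; lia.
have q16 : 2 ^ 4 <= q by rewrite eq_q leq_exp2l.
have : 2 ^ 4 * q ^ 3 <= q ^ 4 by rewrite (expnS q 3) leq_mul2r q16 orbT.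
have : 4 * (4 * 2 ^ (2 * k - 8) * 2 * R) = q ^ 4.
  rewrite /R (expnD q 2 2); move: e; move: (2 ^ (2 * k - 8)) (q ^ 2) => x y <-.
  by rewrite (_ : 2 ^ 8 = 256) //; lia.
have : 0 < q ^ 3 by rewrite expn_gt0 q0.
lia.
Qed.

Lemma exists_scale n : 2 ^ (12 * 44) <= n -> exists i, [/\ 44 <= i, 2 ^ (12 * i) <= n & n < 2 ^ (12 * i.+1)].
Proof.
move=> le; have n0 : 0 < n by apply: leq_trans le; rewrite expn_gt0.
have /andP[l1 l2] := trunc_log_bounds (isT : 1 < 2) n0.
exists (trunc_log 2 n %/ 12); split.
- rewrite leq_divRL // mulnC -ltnS -(ltn_exp2l _ _ (isT : 1 < 2)).
  exact: leq_ltn_trans le l2.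
- by apply: leq_trans l1; rewrite leq_exp2l // mulnC leq_divM.
- by apply: leq_trans l2 _; rewrite leq_exp2l // mulnC -ltn_divLR.
Qed.

Lemma sqr_leq_exp2 i : 44 <= i -> 2 ^ 17 * i ^ 2 <= 2 ^ i.
Proof.
move=> i44; have j11 : 11 <= i %/ 4 by rewrite leq_divRL.
have := divn_eq i 4; have := ltn_pmod i (isT : 0 < 4).
move: (i %/ 4) (i %% 4) j11 => j r j11 r4 ei.
have ij : i <= 2 ^ (j + 2).
  by have := ltn_expl j (isT : 1 < 2); rewrite expnD; move: (2 ^ j) => x; lia.
apply: leq_trans (_ : 2 ^ 17 * (2 ^ (j + 2)) ^ 2 <= _); first by rewrite leq_mul2l leq_exp2r // ij orbT.
by rewrite -expnM -expnD leq_exp2l //; lia.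
Qed.

Lemma mixed_ramsey4_small i n : 44 <= i -> 2 ^ (12 * i) <= n -> n < 2 ^ (12 * i.+1) ->
  mixed_ramsey 4 n * 2 ^ (2 * i) <= 2 ^ 30 * ramsey 4 n.
Proof.
move=> i44 le lt; have n0 : 0 < n by apply: leq_trans le; rewrite expn_gt0.
have up : mixed_ramsey 4 n <= 2 ^ (8 * i + 10) * n * n.
  have := @mixed_ramsey_upper n (2 ^ (8 * i + 8)).
  rewrite -expnM => H; apply: leq_trans (H _) _.
    apply: leq_trans (_ : (2 ^ (12 * i.+1)) ^ 2 <= _); first by rewrite ltn_exp2r.
    by rewrite -expnM leq_exp2l //; lia.
  rewrite leq_mul2r; apply/orP; right; rewrite (_ : 8 * i + 10 = (8 * i + 8) + 2); last by lia.
  rewrite [2 ^ (_ + 2)]expnD; have : 0 < 2 ^ (8 * i + 8) by rewrite expn_gt0.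
  by move: (2 ^ (8 * i + 8)) => t t0; nia.
have low : 2 ^ (22 * i - 8) * n <= ramsey 4 n.
  rewrite (_ : 22 * i - 8 = 2 * (11 * i) - 8); last by lia.
  apply/ltnW/ramsey4_lower; last 1 first.
  - apply: leq_trans le; rewrite (_ : 12 * i = i + 11 * i) ?expnD; last by lia.
    rewrite leq_mul2r; apply/orP; right; apply: leq_trans (sqr_leq_exp2 i44).
    by rewrite expnMn mulnA leq_mul2r; apply/orP; right.
  - apply: leq_trans (_ : 2 ^ i <= _); last by rewrite leq_exp2l //; lia.
    apply: leq_trans (sqr_leq_exp2 i44).
    apply: leq_trans (_ : 2 ^ 8 * i <= _); first by rewrite (_ : 2 ^ 8 = 256) //; lia.
    by rewrite leq_mul ?leq_exp2l // -mulnn leq_pmulr //; lia.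
  - lia.
apply: leq_trans (leq_mul up (leqnn _)) _; apply: leq_trans (leq_mul (leqnn _) low).
rewrite mulnAC [leqRHS]mulnA leq_mul2r; apply/orP; right.
apply: leq_trans (_ : 2 ^ (8 * i + 10) * 2 ^ (12 * i.+1) * 2 ^ (2 * i) <= _).
  by rewrite leq_mul2r leq_mul2l ltnW ?orbT.
by rewrite -!expnD leq_exp2l //; lia.
Qed.

From mathcomp Require Import all_classical all_reals all_analysis.
Import Order.TTheory GRing.Theory Num.Theory.
Import numFieldNormedType.Exports.
Local Open Scope classical_set_scope.
Local Open Scope ring_scope.

Lemma ler_ratio_nat (R : realType) (a b c d : nat) :
  (0 < c)%N -> (a * c <= d * b)%N -> a%:R / b%:R <= d%:R / c%:R :> R.
Proof.
move=> c0 le; have [->|b0] := posnP b; first by rewrite invr0 mulr0 divr_ge0.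
by rewrite ler_pdivrMr ?ltr0n // mulrAC ler_pdivlMr ?ltr0n // -!natrM ler_nat.
Qed.

Theorem theorem1p2 (R : realType) :
  (((mixed_ramsey 4 n)%:R / (ramsey 4 n)%:R : R) @[n --> \oo]) --> (0 : R).
Proof.
apply/cvgrPdist_le => e e0.
pose N := Num.truncn ((2 ^ 30)%:R / e : R).
have ltN : (2 ^ 30)%:R / e < N.+1%:R := truncnS_gt _.
near=> n.
have [i [i44 le lt]] : exists i, [/\ (44 <= i)%N, (2 ^ (12 * i) <= n)%N & (n < 2 ^ (12 * i.+1))%N].
  by apply: exists_scale; near: n; exact: nbhs_infty_ge.
have Ni : (N < i)%N.
  have : (2 ^ (12 * N.+1) <= n)%N by near: n; exact: nbhs_infty_ge.
  by move=> /leq_ltn_trans/(_ lt); rewrite ltn_exp2l // ltn_pmul2l.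
rewrite sub0r normrN ger0_norm ?divr_ge0 //.
have p0 : (0 < 2 ^ (2 * i))%N by rewrite expn_gt0.
apply: le_trans (ler_ratio_nat R p0 (mixed_ramsey4_small i44 le lt)) _.
rewrite ler_pdivrMr ?ltr0n // mulrC -ler_pdivrMr //.
apply: le_trans (ltW ltN) _; rewrite ler_nat; apply: leq_trans Ni _.
by apply: leq_trans (ltnW (ltn_expl i (isT : 1 < 2)%N)) _; rewrite leq_exp2l // leq_pmull.
Unshelve. all: by end_near. Qed.
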